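(* Let $q$ be an odd prime power with $q\equiv 3\pmod 4$, and let $a,b,c\in F_q^\ast$ with $ab=c^2$. Let $\mathcal A$ be the complex vector space with basis $\mathcal C=\{C_i\}_{i\in F_q}$, with bilinear multiplication determined by $C_iC_j=\sum_{k\in F_q}n_{ij}^kC_k$ and conjugate-linear involution determined by $C_i^\ast=C_i$. Then $(\mathcal C,\mathcal A)$ is a hermitian commutative hypergroup (with unit $C_0$).
   Context: $F_q$ is the finite field with $q$ elements and $F_q^\ast$ its set of non-zero elements. For $i\in F_q$ let $C_i=\{(x,y)\in F_q^2: ax^2+by^2=i\}$. Let $N_{ij}^k$ be the number of pairs $(A,B)\in C_i\times C_j$ with $A+B\in C_k$, and $n_{ij}^k=N_{ij}^k/(|C_i||C_j|)$. A (finite) general hypergroup is a pair $(\mathcal K,\mathcal A)$ where $\mathcal A$ is an (associative) $*$-algebra over $\mathbb C$ with unit $c_0$, and $\mathcal K=\{c_0,c_1,\dots,c_n\}\subset\mathcal A$ satisfies: (1) $\mathcal K$ is a basis of $\mathcal A$; (2) $\mathcal K^\ast=\mathcal K$; (3) the structure constants $n_{ij}^k\in\mathbb C$ defined by $c_ic_j=\sum_k n_{ij}^kc_k$ satisfy $c_i^\ast=c_j\Leftrightarrow n_{ij}^0>0$ and $c_i^\ast\ne c_j\Leftrightarrow n_{ij}^0=0$. It is hermitian if $c_i^\ast=c_i$ for all $i$, commutative if $c_ic_j=c_jc_i$ for all $i,j$, positive if $n_{ij}^k\ge0$ for all $i,j,k$, and normalized if $\sum_kn_{ij}^k=1$ for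 all $i,j$. A hypergroup is a general hypergroup that is both positive and normalized. *)

(* Defs.v *)
From HB Require Import structures.
From mathcomp Require Import all_boot all_order all_algebra.
From mathcomp Require Import reals complex.

Set Implicit Arguments.
Unset Strict Implicit.
Unset Printing Implicit Defensive.

Import Order.TTheory GRing.Theory Num.Theory.
Local Open Scope ring_scope.
Local Open Scope complex_scope.

(* The product, unit and involution are explicit operations on a vector space
   rather than an algType structure, so that associativity and the unit laws
   are part of what is_star_algebra asserts. *)
Record is_star_algebra (R : realType) (A : vectType R[i])
    (mul : A -> A -> A) (one : A) (star : A -> A) : Prop := IsStarAlgebra {
  star_mul_linear_l : forall y, linear (mul ^~ y);
  star_mul_linear_r : forall x, linear (mul x);
  star_mulA : associative mul;
  star_mul1l : left_id one mul;
  star_mul1r : right_id one mul;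
  star_conj_linear : forall (z : R[i]) (x y : A),
    star (z *: x + y) = Num.conj z *: star x + star y;
  star_invol : involutive star;
  star_antimul : forall x y, star (mul x y) = mul (star y) (star x)
}.

(* Coordinate of c_i c_j on c_k; meaningful when codom c is a basis of A. *)
Definition structure_const (R : realType) (A : vectType R[i]) (I : finType)
    (mul : A -> A -> A) (c : I -> A) (i j k : I) : R[i] :=
  coord (codom_tuple c) (enum_rank k) (mul (c i) (c j)).

(* The finite family K = {c_0, ..., c_n} is indexed by a finType I, with i0 the
   index of the unit c_0; freeness in basis_of makes c injective.  In R[i],
   0 < z means that z is a positive real. *)
Record general_hypergroup (R : realType) (A : vectType R[i]) (I : finType)
    (mul : A -> A -> A) (star : A -> A) (c : I -> A) (i0 : I) : Prop :=
  GeneralHypergroup {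
  ghyp_star_algebra : is_star_algebra mul (c i0) star;
  ghyp_basis : basis_of fullv (codom c);
  ghyp_star_closed : [seq star x | x <- codom c] =i codom c;
  ghyp_star_eq : forall i j : I,
    star (c i) = c j <-> 0 < structure_const mul c i j i0;
  ghyp_star_neq : forall i j : I,
    star (c i) <> c j <-> structure_const mul c i j i0 = 0
}.

Definition hyp_hermitian (R : realType) (A : vectType R[i]) (I : finType)
    (star : A -> A) (c : I -> A) : Prop :=
  forall i, star (c i) = c i.

Definition hyp_commutative (R : realType) (A : vectType R[i]) (I : finType)
    (mul : A -> A -> A) (c : I -> A) : Prop :=
  forall i j, mul (c i) (c j) = mul (c j) (c i).

Definition hyp_positive (R : realType) (A : vectType R[i]) (I : finType)
    (mul : A -> A -> A) (c : I -> A) : Prop :=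
  forall i j k, 0 <= structure_const mul c i j k.

Definition hyp_normalized (R : realType) (A : vectType R[i]) (I : finType)
    (mul : A -> A -> A) (c : I -> A) : Prop :=
  forall i j, \sum_(k : I) structure_const mul c i j k = 1.

Definition hypergroup (R : realType) (A : vectType R[i]) (I : finType)
    (mul : A -> A -> A) (star : A -> A) (c : I -> A) (i0 : I) : Prop :=
  [/\ general_hypergroup mul star c i0,
      hyp_positive mul c & hyp_normalized mul c].

Definition conic (F : finFieldType) (a b i : F) : {set F * F} :=
  [set p : F * F | a * p.1 ^+ 2 + b * p.2 ^+ 2 == i].

Definition conic_N (F : finFieldType) (a b i j k : F) : nat :=
  #|[set P : (F * F) * (F * F) |
      [&& P.1 \in conic a b i, P.2 \in conic a b j
        & P.1 + P.2 \in conic a b k]]|.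

Definition conic_n (R : realType) (F : finFieldType) (a b i j k : F) : R[i] :=
  (conic_N a b i j k)%:R / (#|conic a b i|%:R * #|conic a b j|%:R).

(* The free complex vector space on the symbols C_i, i in F.  The ^o selects
   the scalar action of R[i] on itself. *)
Definition conic_space (R : realType) (F : finFieldType) : vectType R[i] :=
  {ffun F -> R[i]^o}.

Definition conic_basis (R : realType) (F : finFieldType) (i : F) :
    conic_space R F :=
  [ffun k => (k == i)%:R].

(* The bilinear map sending (C_i, C_j) to \sum_k n_ij^k C_k. *)
Definition conic_mul (R : realType) (F : finFieldType) (a b : F)
    (f g : conic_space R F) : conic_space R F :=
  \sum_(i : F) \sum_(j : F) (f i * g j) *:
    \sum_(k : F) conic_n R a b i j k *: conic_basis R k.

(* The conjugate-linear map fixing every C_i. *)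
Definition conic_star (R : realType) (F : finFieldType)
    (f : conic_space R F) : conic_space R F :=
  \sum_(i : F) Num.conj (f i : R[i]) *: conic_basis R i.

(* Main.v *)
Require Import Defs.
From HB Require Import structures.
From mathcomp Require Import all_boot all_order all_algebra.
From mathcomp Require Import all_fingroup all_solvable all_field ring zify.
From mathcomp Require Import reals complex.

Import Order.TTheory GRing.Theory Num.Theory.
Local Open Scope ring_scope.

(* Since -1 is not a square, a Q(x, y) = (a x)^2 + (c y)^2 shows that the form
   Q(x, y) = a x^2 + b y^2 is anisotropic.  Hence the reflection in Z - W is
   defined whenever Z <> W and Q(Z) = Q(W); it is an isometry exchanging Z and
   W.  So the number of C in C_l with Z + C in C_m depends only on Q(Z), and
   sum_k n_ij^k n_kl^m is, up to the factor 1 / (|C_i| |C_j| |C_l|), the number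
   of triples in C_i x C_j x C_l with sum in C_m, which is symmetric in
   i, j, l.  With commutativity this gives associativity.  No C_i is empty:
   every element is a square or minus a square, so more than half of F are
   squares, and the sets a S and i - b S, with S the set of squares, meet. *)

(** * Squares in a finite field of order 3 modulo 4 *)

Section FieldOfCard3Mod4.

Local Set Implicit Arguments.
Local Unset Strict Implicit.

Variables (F : finFieldType) (hq : #|F| = 3 %[mod 4]).

Lemma card_3mod4E : exists m, #|F| = (4 * m + 3)%N.
Proof. by exists (#|F| %/ 4)%N; lia. Qed.

(** By Lagrange in the additive group, [#|F|%:R] is 0; if 2 were 0, oddness of the order would make
    it 1. *)
Lemma two_neq0_card_3mod4 : 2%:R != 0 :> F.
Proof.
have [m qE] := card_3mod4E.
apply/eqP => two0.
have : #|F|%:R == 0 :> F by rewrite -FinRing.zmodXgE -cardsT expg_cardG ?inE.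
have -> : #|F| = ((2 * m + 1) * 2 + 1)%N by rewrite qE; lia.
by rewrite natrD natrM two0 mulr0 add0r oner_eq0.
Qed.

(** If [y] is nonzero, t = x / y has t^2 = -1, and with q = 2(2m+1) + 1 this gives t^q = -t. But t^q
    = t, so 2t = 0 and t = 0, contradicting t^2 = -1. *)
Lemma sumsq_eq0_card_3mod4 (x y : F) :
  x ^+ 2 + y ^+ 2 = 0 -> x = 0 /\ y = 0.
Proof.
move=> xy0; have y0 : y = 0.
  apply/eqP/negP => /negP y_neq0; have [m qE] := card_3mod4E.
  have t2 : (x / y) ^+ 2 = -1.
    by rewrite expr_div_n -(opprK (x ^+ 2)) (addr0_eq xy0) mulNr
      divff ?expf_neq0.
  have : (x / y) ^+ #|F| = x / y by exact: expf_card.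
  have -> : #|F| = (2 * (2 * m + 1) + 1)%N by rewrite qE; lia.
  rewrite exprD exprM t2 expr1 addn1 exprS exprM sqrrN expr1n !expr1n.
  rewrite mulr1 mulN1r.
  move=> /eqP; rewrite eq_sym -subr_eq0 opprK -mulr2n -mulr_natr mulf_eq0.
  rewrite (negPf two_neq0_card_3mod4) orbF => /eqP t0.
  by move: t2; rewrite t0 expr0n => /eqP; rewrite eq_sym oppr_eq0 oner_eq0.
by move: xy0; rewrite y0 expr0n addr0 => /eqP; rewrite sqrf_eq0 => /eqP ->.
Qed.

Lemma sqr_or_oppsqr_card_3mod4 (x : F) : exists y, x = y ^+ 2 \/ x = - y ^+ 2.
Proof.
(* The witness squares to x * x^(2m+1), and for x nonzero x^(2m+1) is 1 or -1 because its square is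
   x^(q-1) = 1. *)
have [m qE] := card_3mod4E; exists (x ^+ m.+1); rewrite -exprM.
have [->|x_neq0] := eqVneq x 0; first by left; rewrite expr0n muln_eq0 /=.
have : x ^+ (2 * (2 * m + 1)) == 1.
  rewrite -(inj_eq (mulfI x_neq0)) mulr1 -exprS -[X in _ == X]expf_card.
  by rewrite qE; apply/eqP; congr (_ ^+ _); lia.
rewrite mulnC exprM sqrf_eq1 (_ : m.+1 * 2 = (2 * m + 1).+1)%N; last by lia.
rewrite exprS => /orP[] /eqP ->; [left|right]; first by rewrite mulr1.
by rewrite mulrN1 opprK.
Qed.

Lemma card_squares_3mod4 : (#|F| < 2 * #|[set x ^+ 2 | x : F]|)%N.
Proof.
set S := [set _ | _ in _]; have [m qE] := card_3mod4E.
(* The strict inequality comes for free, since the order is odd. *)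
suff : (#|F| <= #|S| + #|S|)%N by lia.
have {2}<- : #|[set - s | s in S]| = #|S| by apply/card_imset/oppr_inj.
rewrite -cardsT; apply: leq_trans (leq_card_setU _ _).
apply/subset_leq_card/subsetP => x _; rewrite inE.
have [y [] ->] := sqr_or_oppsqr_card_3mod4 x; apply/orP; [left|right].
  exact: imset_f.
by apply/imset_f/imset_f.
Qed.

Lemma binary_form_universal (a b i : F) : a != 0 -> b != 0 ->
  exists x y, a * x ^+ 2 + b * y ^+ 2 = i.
Proof.
move=> ha hb; have hS := card_squares_3mod4; set S := [set _ | _ in _] in hS.
pose S1 := [set a * s | s in S]; pose S2 := [set i - b * s | s in S].
have c1 : #|S1| = #|S| by apply/card_imset/mulfI.
have c2 : #|S2| = #|S|.
  by apply: card_imset => s t /addrI /oppr_inj; apply: mulfI.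
have /set0Pn [z] : S1 :&: S2 != set0.
  apply/negP => /eqP dis.
  have := cardsUI S1 S2; rewrite dis cards0 addn0 c1 c2 => cU.
  have := subset_leq_card (subsetT (S1 :|: S2)).
  by rewrite cardsT cU addnn -mul2n leqNgt hS.
rewrite inE => /andP[/imsetP[_ /imsetP[x _ ->] ->]].
move=> /imsetP[_ /imsetP[y _ ->] E].
by exists x, y; rewrite E subrK.
Qed.

End FieldOfCard3Mod4.

(** * Reflections and point counts for an anisotropic binary form *)

Section AnisotropicConics.

Local Set Implicit Arguments.
Local Unset Strict Implicit.

Variables (F : finFieldType) (a b : F).

Definition qform (p : F * F) : F := a * p.1 ^+ 2 + b * p.2 ^+ 2.

Lemma in_conic i p : (p \in conic a b i) = (qform p == i).
Proof. by rewrite inE. Qed.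

Lemma qformN p : qform (- p) = qform p.
Proof. by rewrite /qform /= !sqrrN. Qed.

(** The orthogonal reflection v - (2 B(v, d) / Q(d)) d, where B is the symmetric bilinear form with
    B(v, v) = Q(v). *)
Definition qreflect (d v : F * F) : F * F :=
  let t := 2%:R * (a * v.1 * d.1 + b * v.2 * d.2) / qform d in
  (v.1 - t * d.1, v.2 - t * d.2).

Lemma qreflectD d v w : qreflect d (v + w) = qreflect d v + qreflect d w.
Proof. by rewrite /qreflect; congr (_, _) => /=; ring. Qed.

Lemma qform_reflect d v : qform d != 0 -> qform (qreflect d v) = qform v.
Proof. by rewrite /qreflect /qform /= => d0; field. Qed.

Lemma qreflectK d : qform d != 0 -> involutive (qreflect d).
Proof.
by rewrite /qform => d0 [x y]; rewrite /qreflect /qform /=; congr (_, _); field.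
Qed.

(** Since 2 B(z, z - w) - Q(z - w) = Q(z) - Q(w) = 0, the reflection coefficient is 1 and z goes to
    z - (z - w). *)
Lemma qreflect_sub z w : qform (z - w) != 0 -> qform z = qform w ->
  qreflect (z - w) z = w.
Proof.
move=> d0 zw; rewrite /qreflect.
have -> : 2%:R * (a * z.1 * (z - w).1 + b * z.2 * (z - w).2) = qform (z - w).
  apply/eqP; rewrite -subr_eq0 (_ : _ - _ = qform z - qform w).
    by rewrite zw subrr.
  by rewrite /qform /=; ring.
by rewrite divff // !mul1r /= !subKr -surjective_pairing.
Qed.

Hypothesis qform_aniso : forall p, qform p = 0 -> p = 0.

Lemma conic0 : conic a b 0 = [set (0 : F * F)].
Proof.
apply/setP => p; rewrite in_conic inE; apply/eqP/eqP => [/qform_aniso //|->].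
by rewrite /qform /= !expr0n !mulr0 addr0.
Qed.

Definition slice (Z : F * F) (l m : F) : nat :=
  #|[set C | (C \in conic a b l) && (Z + C \in conic a b m)]|.

Lemma slice_qform Z W l m : qform Z = qform W -> slice Z l m = slice W l m.
Proof.
move=> ZW; have [->//|Z_neq_W] := eqVneq Z W.
have d0 : qform (Z - W) != 0.
  by apply: contraNneq Z_neq_W => /qform_aniso /eqP; rewrite subr_eq0.
rewrite /slice -(card_imset _ (can_inj (qreflectK d0))); apply: eq_card => C.
rewrite -[C in LHS](qreflectK d0) mem_imset ?inE; last exact/can_inj/qreflectK.
rewrite -/(qform _) -/(qform (Z + _)) -/(qform C) -/(qform (W + C)).
(* With r the reflection in Z - W: Q(Z + r C) = Q(r (Z + r C)) = Q(W + C). *)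
rewrite -(qform_reflect (Z + _) d0) qreflectD qreflectK // qreflect_sub //.
by rewrite qform_reflect.
Qed.

Lemma conic_N_sum i j k : conic_N a b i j k =
  (\sum_(A in conic a b i) \sum_(B in conic a b j)
    ((A + B)%R \in conic a b k))%N.
Proof.
rewrite /conic_N -sum1_card pair_big_dep /= big_mkcond [RHS]big_mkcond /=.
by apply: eq_bigr => P _; rewrite !inE; do 2!case: (_ == _); case: (_ == _).
Qed.

Lemma sliceE Z l m :
  slice Z l m = (\sum_(C in conic a b l) ((Z + C)%R \in conic a b m))%N.
Proof.
rewrite /slice -sum1_card big_mkcond [RHS]big_mkcond /=.
by apply: eq_bigr => P _; rewrite !inE; do 2!case: (_ == _).
Qed.

Lemma conic_N_slice k l m Z : Z \in conic a b k ->
  conic_N a b k l m = (#|conic a b k| * slice Z l m)%N.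
Proof.
rewrite in_conic => /eqP Zk; rewrite conic_N_sum -sum_nat_const.
apply: eq_bigr => A; rewrite in_conic => /eqP Ak; rewrite -sliceE.
by apply: slice_qform; rewrite Ak.
Qed.

Lemma conic_NC i j k : conic_N a b i j k = conic_N a b j i k.
Proof.
rewrite !conic_N_sum exchange_big; apply: eq_bigr => B _.
by apply: eq_bigr => A _; rewrite addrC.
Qed.

Lemma sum_conic_N i j :
  (\sum_k conic_N a b i j k = #|conic a b i| * #|conic a b j|)%N.
Proof.
under eq_bigr do rewrite conic_N_sum.
rewrite exchange_big -sum_nat_const; apply: eq_bigr => A _.
rewrite exchange_big -[RHS]muln1 -sum_nat_const; apply: eq_bigr => B _.
(* The conics partition the plane, so A + B lies on exactly one of them. *)
rewrite (bigD1 (qform (A + B))) //= in_conic eqxx big1 // => k.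
by rewrite in_conic eq_sym => /negPf ->.
Qed.

(** By anisotropy C_0 contains only the origin, so B must be -A, which lies on the same conic as
    A. *)
Lemma conic_N_0r i j :
  conic_N a b i j 0 = if i == j then #|conic a b i| else 0%N.
Proof.
rewrite conic_N_sum.
rewrite (eq_bigr (fun=> nat_of_bool (i == j))) => [|A]; last first.
  rewrite in_conic => /eqP Ai.
  rewrite big_mkcond (bigD1 (- A)) //= big1 => [|B BA].
    by rewrite conic0 in_conic qformN Ai subrr inE eqxx addn0; case: ifP.
  by rewrite conic0 in_set1 addrC addr_eq0 (negPf BA) if_same.
by rewrite sum_nat_const; case: eqP => _; rewrite ?muln1 ?muln0.
Qed.

Lemma conic_N_0l j k :
  conic_N a b 0 j k = if j == k then #|conic a b j| else 0%N.
Proof.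
rewrite conic_N_sum conic0 big_set1 (eq_bigr (fun=> nat_of_bool (j == k))).
  by rewrite sum_nat_const; case: eqP => _; rewrite ?muln1 ?muln0.
by move=> B; rewrite add0r !in_conic => /eqP ->.
Qed.

Definition conic_triples (i j l m : F) : nat :=
  (\sum_(A in conic a b i) \sum_(B in conic a b j) \sum_(C in conic a b l)
    ((A + B + C)%R \in conic a b m))%N.

Lemma conic_triples_rot i j l m : conic_triples i j l m = conic_triples j l i m.
Proof.
rewrite /conic_triples exchange_big; apply: eq_bigr => B _.
rewrite exchange_big; apply: eq_bigr => C _.
by apply: eq_bigr => A _; rewrite -addrA addrC.
Qed.

Variable R : realType.

(** A pair (A, B) contributes only at k = Q(A + B). There N_kl^m / |C_k| is the size of the slice at
    A + B, that is, the number of ways to complete the pair to a triple. *)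
Lemma sum_conic_N_triples i j l m :
  \sum_k (conic_N a b i j k)%:R * ((conic_N a b k l m)%:R / #|conic a b k|%:R)
  = (conic_triples i j l m)%:R :> R[i].
Proof.
rewrite /conic_triples; under [LHS]eq_bigr do rewrite conic_N_sum.
under [LHS]eq_bigr do rewrite natr_sum mulr_suml.
rewrite exchange_big natr_sum; apply: eq_bigr => A _.
under eq_bigr do rewrite natr_sum mulr_suml.
rewrite exchange_big natr_sum; apply: eq_bigr => B _.
rewrite -sliceE (bigD1 (qform (A + B))) //= in_conic eqxx mul1r.
have AB : A + B \in conic a b (qform (A + B)) by rewrite in_conic.
rewrite (conic_N_slice _ _ AB) natrM mulrAC divff ?mul1r; last first.
  by rewrite pnatr_eq0 -lt0n; apply/card_gt0P; exists (A + B).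
rewrite big1 ?addr0 // => k.
by rewrite in_conic eq_sym => /negPf ->; rewrite mul0r.
Qed.

Local Notation n := (@conic_n R F a b).

Lemma conic_nC i j k : n i j k = n j i k.
Proof. by rewrite /conic_n conic_NC [X in _ / X]mulrC. Qed.

Lemma sum_conic_n_triples i j l m : \sum_k n i j k * n k l m =
  (conic_triples i j l m)%:R
    / (#|conic a b i|%:R * #|conic a b j|%:R * #|conic a b l|%:R).
Proof.
rewrite -sum_conic_N_triples mulr_suml; apply: eq_bigr => k _.
by rewrite /conic_n !invfM; ring.
Qed.

(** In terms of the product: (C_i C_j) C_l = (C_j C_l) C_i, which commutativity turns into
    associativity. *)
Lemma conic_n_rot i j l m :
  \sum_k n i j k * n k l m = \sum_k n j l k * n k i m.
Proof.
rewrite !sum_conic_n_triples conic_triples_rot.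
by congr (_ / _); ring.
Qed.

Hypothesis qform_univ : forall i, exists p, qform p = i.

Lemma card_conic_gt0 i : (0 < #|conic a b i|)%N.
Proof.
by have [p <-] := qform_univ i; apply/card_gt0P; exists p; rewrite in_conic.
Qed.

Lemma card_conic_neq0 i : #|conic a b i|%:R != 0 :> R[i].
Proof. by rewrite pnatr_eq0 -lt0n card_conic_gt0. Qed.

Lemma sum_conic_n i j : \sum_k n i j k = 1.
Proof.
rewrite /conic_n -mulr_suml -natr_sum sum_conic_N natrM divff //.
by rewrite mulf_neq0 ?card_conic_neq0.
Qed.

Lemma conic_n_ge0 i j k : 0 <= n i j k.
Proof. by rewrite divr_ge0 ?mulr_ge0 ?ler0n. Qed.

Lemma conic_n_0l j k : n 0 j k = (j == k)%:R.
Proof.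
rewrite /conic_n conic_N_0l conic0 cards1 mul1r; case: eqP => _.
  by rewrite divff ?card_conic_neq0.
by rewrite mul0r.
Qed.

Lemma conic_n_0r_gt0 i j : (0 < n i j 0) = (i == j).
Proof.
rewrite /conic_n conic_N_0r; case: eqP => _; last by rewrite mul0r ltxx.
by rewrite divr_gt0 ?mulr_gt0 ?ltr0n ?card_conic_gt0.
Qed.

Lemma conic_n_0r_eq0 i j : (n i j 0 == 0) = (i != j).
Proof. by rewrite -conic_n_0r_gt0 lt0r conic_n_ge0 andbT negbK. Qed.

End AnisotropicConics.

(** * The algebra spanned by the conics, and the hypergroup axioms *)

Section ConicSpace.

Local Set Implicit Arguments.
Local Unset Strict Implicit.

Variables (R : realType) (F : finFieldType) (a b : F).
Implicit Types f g h : conic_space R F.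
Local Notation n := (@conic_n R F a b).
Local Notation e := (@conic_basis R F).
Local Notation mul := (@conic_mul R F a b).
Local Notation star := (@conic_star R F).

Lemma sum_conic_basisE (x : F -> R[i]) k : (\sum_i x i *: e i) k = x k.
Proof.
rewrite sum_ffunE (bigD1 k) //= !ffunE eqxx big1 => [|i ik].
  by rewrite addr0 /GRing.scale /= mulr1.
by rewrite !ffunE eq_sym (negPf ik) /GRing.scale /= mulr0.
Qed.

Lemma conic_starE f k : star f k = Num.conj (f k : R[i]).
Proof. exact: sum_conic_basisE. Qed.

Lemma conic_mulE f g k :
  mul f g k = \sum_i \sum_j f i * g j * n i j k :> R[i].
Proof.
rewrite sum_ffunE; apply: eq_bigr => i _.
rewrite sum_ffunE; apply: eq_bigr => j _.
by rewrite ffunE sum_conic_basisE.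
Qed.

Lemma sum_delta (x : F -> R[i]) i : \sum_k (k == i)%:R * x k = x i.
Proof.
rewrite (bigD1 i) //= eqxx mul1r big1 ?addr0 // => k /negPf ->.
by rewrite mul0r.
Qed.

Lemma conic_mul_basisE i j : mul (e i) (e j) = \sum_k n i j k *: e k.
Proof.
apply/ffunP => k; rewrite conic_mulE sum_conic_basisE.
rewrite -(sum_delta (fun i => n i j k)); apply: eq_bigr => i' _.
rewrite -(sum_delta (fun j => n i' j k)) mulr_sumr; apply: eq_bigr => j' _.
by rewrite !ffunE mulrA.
Qed.

Lemma conic_mulC : commutative mul.
Proof.
move=> f g; apply/ffunP => k; rewrite !conic_mulE exchange_big.
apply: eq_bigr => j _; apply: eq_bigr => i _.
by rewrite conic_nC (mulrC (f i : R[i])).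
Qed.

Lemma conic_mul_linear_l g : linear (mul ^~ g).
Proof.
move=> z f f'; apply/ffunP => k; rewrite !ffunE !conic_mulE.
rewrite [X in _ = X + _]mulr_sumr -big_split; apply: eq_bigr => i _ /=.
rewrite mulr_sumr -big_split; apply: eq_bigr => j _ /=.
by rewrite !ffunE /GRing.scale /=; ring.
Qed.

Lemma conic_star_basis i : star (e i) = e i.
Proof. by apply/ffunP => k; rewrite conic_starE ffunE conjC_nat. Qed.

Lemma conic_starK : involutive star.
Proof. by move=> f; apply/ffunP => k; rewrite !conic_starE conjCK. Qed.

Lemma conic_star_conj_linear (z : R[i]) f g :
  star (z *: f + g) = Num.conj z *: star f + star g.
Proof.
apply/ffunP => k; rewrite !(conic_starE, ffunE) rmorphD.
by congr (_ + _); exact: rmorphM.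
Qed.

(** Conjugation fixes each n_ij^k, a quotient of natural numbers. Commutativity later reverses the
    factors. *)
Lemma conic_starM f g : star (mul f g) = mul (star f) (star g).
Proof.
apply/ffunP => k; rewrite conic_starE !conic_mulE rmorph_sum.
apply: eq_bigr => i _; rewrite rmorph_sum; apply: eq_bigr => j _.
rewrite !conic_starE !rmorphM; congr (_ * _).
by rewrite fmorphV rmorphM !rmorph_nat.
Qed.

Lemma nth_codom_conic_basis i0 (i : 'I_#|F|) :
  nth i0 (codom e) i = e (enum_val i).
Proof.
by rewrite (nth_map (enum_default i)) ?cardE -?cardE // -enum_val_nth.
Qed.

Lemma conic_basis_free : free (codom_tuple e).
Proof.
(* Evaluating a vanishing combination at the point [enum_val i] isolates its [i]-th coefficient. *)
apply/freeP => x x0 i; have := congr1 (fun f => f (enum_val i)) x0.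
rewrite (eq_bigr (fun j => x (enum_rank (enum_val j)) *: e (enum_val j))).
  rewrite -(big_enum_val (fun k => x (enum_rank k) *: e k)) /=.
  by rewrite sum_conic_basisE enum_valK ffunE.
by move=> j _; rewrite enum_valK nth_codom_conic_basis.
Qed.

Lemma conic_basis_of : basis_of fullv (codom e).
Proof.
rewrite basisEfree [free _]conic_basis_free subvf.
apply: leq_trans (dim_span _); apply: dimvS.
apply/subvP => f _; rewrite (_ : f = \sum_k f k *: e k); last first.
  by apply/ffunP => k; rewrite sum_conic_basisE.
by apply: rpred_sum => k _; apply/rpredZ/memv_span/codom_f.
Qed.

Lemma conic_structure_const i j k : structure_const mul e i j k = n i j k.
Proof.
rewrite /structure_const conic_mul_basisE.
(* Reindexing from [F] to ordinals matches the order of [codom], in which [coord] reads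
   coefficients. *)
rewrite (big_enum_val (fun k => n i j k *: e k)) /=.
rewrite (eq_bigr (fun l => n i j (enum_val l) *: (codom_tuple e)`_l)).
  by rewrite coord_sum_free ?conic_basis_free // enum_rankK.
by move=> l _; rewrite nth_codom_conic_basis.
Qed.

Lemma conic_basis_inj : injective e.
Proof.
move=> i j /(congr1 (fun f => f i)); rewrite !ffunE eqxx => /eqP.
by case: (i =P j) => // _; rewrite oner_eq0.
Qed.

Hypothesis qform_aniso : forall p, qform a b p = 0 -> p = 0.
Hypothesis qform_univ : forall i, exists p, qform a b p = i.

Lemma conic_mul1 : left_id (e 0) mul.
Proof.
move=> f; apply/ffunP => k; rewrite conic_mulE.
rewrite (bigD1 0) //= [X in _ + X]big1 => [|i i0]; last first.
  by rewrite big1 // => j _; rewrite ffunE (negPf i0) !mul0r.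
rewrite addr0 -[RHS](sum_delta f k); apply: eq_bigr => j _.
by rewrite ffunE eqxx mul1r conic_n_0l // mulrC.
Qed.

(** Collects the inner sum over [k] in the shape to which [conic_n_rot] applies. *)
Lemma conic_mul_mulE f g h m : mul (mul f g) h m =
  \sum_i \sum_j \sum_l f i * g j * h l * \sum_k n i j k * n k l m :> R[i].
Proof.
rewrite conic_mulE exchange_big /=.
rewrite [RHS](eq_bigr (fun i => \sum_l \sum_j
   f i * g j * h l * \sum_k n i j k * n k l m)); last first.
  by move=> i _; rewrite exchange_big.
rewrite [RHS]exchange_big; apply: eq_bigr => l _ /=.
under eq_bigr do rewrite conic_mulE -mulrA mulr_suml.
rewrite exchange_big; apply: eq_bigr => i _ /=.
under eq_bigr do rewrite mulr_suml.
rewrite exchange_big; apply: eq_bigr => j _ /=.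
by rewrite mulr_sumr; apply: eq_bigr => k _; ring.
Qed.

Lemma conic_mulA : associative mul.
Proof.
(* Commutativity replaces f (g h) by (g h) f, so both sides are left-nested and differ by a rotation
   of the indices. *)
move=> f g h; rewrite conic_mulC; apply/ffunP => m; rewrite !conic_mul_mulE.
rewrite [RHS]exchange_big; apply: eq_bigr => j _ /=.
rewrite [RHS]exchange_big; apply: eq_bigr => l _ /=.
apply: eq_bigr => i _; rewrite [in RHS]conic_n_rot //.
by congr (_ * _); ring.
Qed.

Lemma conic_star_algebra : is_star_algebra mul (e 0) star.
Proof.
split.
- exact: conic_mul_linear_l.
- by move=> f z g h; rewrite !(conic_mulC f) conic_mul_linear_l.
- exact: conic_mulA.
- exact: conic_mul1.
- by move=> f; rewrite conic_mulC conic_mul1.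
- exact: conic_star_conj_linear.
- exact: conic_starK.
- by move=> f g; rewrite conic_starM conic_mulC.
Qed.

Lemma conic_hypergroup : hypergroup mul star e 0.
Proof.
split; last 2 first.
- by move=> i j k; rewrite conic_structure_const conic_n_ge0.
- move=> i j; rewrite -[RHS](sum_conic_n R qform_univ i j).
  by apply: eq_bigr => k _; rewrite conic_structure_const.
split.
- exact: conic_star_algebra.
- exact: conic_basis_of.
- rewrite (eq_in_map star id _).1 ?map_id // => _ /codomP[i ->].
  exact: conic_star_basis.
- move=> i j; rewrite conic_star_basis conic_structure_const conic_n_0r_gt0 //.
  by split=> [/conic_basis_inj ->|/eqP ->].
- move=> i j; rewrite conic_star_basis conic_structure_const.
  split=> [ij|/eqP]; last first.
    rewrite conic_n_0r_eq0 // => ij /conic_basis_inj /eqP.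
    by rewrite (negPf ij).
  by apply/eqP; rewrite conic_n_0r_eq0 //; apply/eqP => /(congr1 e).
Qed.

End ConicSpace.

Theorem mainTheorem5 (R : realType) (F : finFieldType)
  (hq : #|F| = 3 %[mod 4]) (a b c : F)
  (ha : a != 0) (hb : b != 0) (hc : c != 0) (hab : a * b = c ^+ 2) :
  [/\ hypergroup (@conic_mul R F a b) (@conic_star R F)
        (@conic_basis R F) 0,
      hyp_hermitian (@conic_star R F) (@conic_basis R F)
    & hyp_commutative (@conic_mul R F a b) (@conic_basis R F)].
Proof.
split; last by move=> i j; apply: conic_mulC.
  apply: conic_hypergroup => [[x y]|i]; last first.
    by have [x [y <-]] := binary_form_universal hq i ha hb; exists (x, y).
  rewrite /qform /= => q0.
  have : (a * x) ^+ 2 + (c * y) ^+ 2 = 0.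
    by rewrite !exprMn -hab -[RHS](mulr0 a) -q0; ring.
  move=> /(sumsq_eq0_card_3mod4 hq) [/eqP + /eqP].
  by rewrite !mulf_eq0 (negPf ha) (negPf hc) => /eqP -> /eqP ->.
by move=> i; apply: conic_star_basis.
Qed.
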